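(* Let $\mathbb{F}\in\{\mathbb{R},\mathbb{C}\}$, let $\mathcal{X}\subset\mathbb{F}^{n\times n}$ be a $k$-dimensional subspace (over $\mathbb{F}$), and let $Y\in\mathbb{F}^{n\times n}\setminus\mathcal{X}$ and $X_*\in\mathcal{X}$ be given. Then the following are equivalent: (1) $X_*$ is a spectral approximation of $Y$ from $\mathcal{X}$, i.e., $\|Y-X_*\|_2=\min_{X\in\mathcal{X}}\|Y-X\|_2$. (2) There exist $\ell$ rank-one matrices $u_1v_1^H,\dots,u_\ell v_\ell^H\in\mathbb{F}^{n\times n}$, with $u_i,v_i\in\mathbb{F}^n$ and $\|u_i\|_2=\|v_i\|_2=1$ for $i=1,\dots,\ell$, where $1\le\ell\le k+1$ if $\mathbb{F}=\mathbb{R}$ and $1\le\ell\le 2k+1$ if $\mathbb{F}=\mathbb{C}$, and $\ell$ positive real numbers $\omega_1,\dots,\omega_\ell$ with $\omega_1+\dots+\omega_\ell=1$, such that $$\sum_{j=1}^{\ell}\omega_j\,u_j^HXv_j=0\quad\text{for all }X\in\mathcal{X},$$ and $$u_j^H(Y-X_* )v_j=\|Y-X_*\|_2\quad\text{for }j=1,\dots,\ell.$$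
   Context: For $v\in\mathbb{F}^n$, $\|v\|_2=(v^Hv)^{1/2}$ is the Euclidean norm, where $v^H$ is the conjugate transpose (the transpose if $\mathbb{F}=\mathbb{R}$). For $A\in\mathbb{F}^{n\times n}$, $\|A\|_2=\max_{v\in\mathbb{F}^n,\ \|v\|_2=1}\|Av\|_2$ is the spectral norm. *)

(* Defs.v *)
From HB Require Import structures.
From mathcomp Require Import all_boot all_order all_algebra.
From mathcomp Require Import boolp classical_sets reals.
From mathcomp Require Import complex.

Set Implicit Arguments.
Unset Strict Implicit.
Unset Printing Implicit Defensive.

Import Order.TTheory GRing.Theory Num.Theory.
Local Open Scope ring_scope.

(* All constructions below are uniform in the choice of the scalar field,
   either R itself (K = RealScalars) or R[i] (K = ComplexScalars); norms always
   take their values in R. *)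
Variant scalars := RealScalars | ComplexScalars.

Definition scalar_field (R : realType) (K : scalars) : numFieldType :=
  match K with
  | RealScalars => (R : numFieldType)
  | ComplexScalars => (R[i] : numFieldType)
  end.

Definition scalar_conj (R : realType) (K : scalars) :
    {rmorphism scalar_field R K -> scalar_field R K} :=
  match K return {rmorphism scalar_field R K -> scalar_field R K} with
  | RealScalars => (idfun : {rmorphism R -> R})
  | ComplexScalars => (@conjc R : {rmorphism R[i] -> R[i]})
  end.

Definition scalar_of_real (R : realType) (K : scalars) :
    {rmorphism R -> scalar_field R K} :=
  match K return {rmorphism R -> scalar_field R K} with
  | RealScalars => (idfun : {rmorphism R -> R})
  | ComplexScalars => (real_complex R : {rmorphism R -> R[i]})
  end.

Definition scalar_re (R : realType) (K : scalars) : scalar_field R K -> R :=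
  match K return scalar_field R K -> R with
  | RealScalars => id
  | ComplexScalars => @complex.Re R
  end.

Definition max_terms (K : scalars) (k : nat) : nat :=
  match K with
  | RealScalars => k.+1
  | ComplexScalars => k.*2.+1
  end.

Section SpectralNorm.
Variables (R : realType) (K : scalars).
Local Notation F := (scalar_field R K).

Definition ctrmx m n (A : 'M[F]_(m, n)) : 'M[F]_(n, m) :=
  map_mx (scalar_conj R K) A^T.

(* v^H v is a nonnegative real scalar, so taking its real part only changes its
   type. *)
Definition vnorm2 n (v : 'cV[F]_n) : R :=
  Num.sqrt (scalar_re ((ctrmx v *m v) 0 0)).

(* The set is nonempty for n > 0, bounded, and contains its supremum by
   compactness of the unit sphere, so that the supremum is a maximum. *)
Definition spectral_norm n (A : 'M[F]_n) : R :=
  sup [set vnorm2 (A *m v) | v in [set v : 'cV[F]_n | vnorm2 v = 1]].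

Definition spectral_approximation n (Y : 'M[F]_n)
    (XX : {vspace 'M[F]_n}) (Xs : 'M[F]_n) : Prop :=
  Xs \in XX /\
  forall X, X \in XX -> spectral_norm (Y - Xs) <= spectral_norm (Y - X).

End SpectralNorm.

(* Main.v *)
Require Import Defs.
From HB Require Import structures.
From mathcomp Require Import all_boot all_order all_algebra.
From mathcomp Require Import boolp classical_sets reals.
From mathcomp Require Import complex.
From mathcomp Require Import topology normedtype derive.
From mathcomp Require Import ring lra.

Set Implicit Arguments.
Unset Strict Implicit.
Unset Printing Implicit Defensive.

Import Order.TTheory GRing.Theory Num.Theory.
Import numFieldNormedType.Exports.
Local Open Scope ring_scope.

(** Write D = Y - X_*, rho = ||D||, and <u, v> for Re (u^H v).  The spectral
norm is a maximum of real-linear functionals of A,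
    ||A|| = max <u, A v>   over pairs of unit vectors (u, v)
([spectral_norm_variational]), so that best approximation is a linear
Chebyshev problem over the compact set of such pairs.

Given unit vectors and weights as in the theorem, averaging <u_j, . v_j> with
the weights w_j gives a functional of norm at most 1 that annihilates the
subspace and takes the value rho at D; hence ||Y - X|| >= rho for every X in the
subspace.

Conversely, let G_1, ..., G_m generate the subspace over the reals (m = k or
2k), and map each pair z = (u, v) to the point b(z) of R^m with coordinates <u,
G_i v>.  Optimality of X_* says that for every x in R^m some pair z has <u, D v>
- x.b(z) >= rho.  By Kolmogorov's criterion ([kolmogorov_criterion]) the origin
is then a convex combination of points b(z) taken at extremal pairs, those with
<u, D v> = rho: otherwise a hyperplane separates the origin from the compact set
of these points, and a small step along its normal lowers the norm at all pairs
at once.  The bound m + 1 on the number of terms is Caratheodory's theorem.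

Only real parts occur in this argument.  They suffice, because a subspace over
the complex numbers is stable under multiplication by i, so that a linear
functional whose real part vanishes on it vanishes there ([annihilate_re]), and
because an extremal pair satisfies D v = rho u by the equality case of Cauchy-
Schwarz, so that u^H D v is the real number rho ([extremal_pair_eq]). *)

(** * Convex combinations in R^m *)

Section Barycenters.
Variables (R : realFieldType) (m : nat).

(** The points, extended by a coordinate 1, are l vectors in dimension m + 1, so
they satisfy a nontrivial linear relation, whose coefficients sum to 0.
Subtracting the largest multiple of it that keeps the weights nonnegative makes
one of them vanish. *)
Lemma barycenter_vanishing_weight l (b : 'I_l -> 'rV[R]_m) (w : 'I_l -> R) :
  (m.+1 < l)%N -> (forall j, 0 <= w j) -> \sum_j w j = 1 ->
  exists w' : 'I_l -> R, [/\ forall j, 0 <= w' j, \sum_j w' j = 1,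
    \sum_j w' j *: b j = \sum_j w j *: b j & exists j, w' j = 0].
Proof.
move=> ltml w0 w1.
pose M : 'M[R]_(l, 1 + m) := row_mx (const_mx 1) (\matrix_j b j).
have /rowV0Pn[c /sub_kermxP cM c0] : kermx M != 0.
  by rewrite -mxrank_eq0 mxrank_ker -lt0n subn_gt0 (leq_ltn_trans (rank_leq_col M)).
move: cM; rewrite mul_mx_row => /eqP; rewrite row_mx_eq0 => /andP[/eqP cs /eqP cb].
have {}cs : \sum_j c 0 j = 0.
  move/matrixP/(_ 0 0): cs; rewrite !mxE => cs; rewrite -[RHS]cs.
  apply: eq_bigr => j _; by rewrite mxE mulr1.
have {}cb : \sum_j c 0 j *: b j = 0.
  by rewrite -[RHS]cb mulmx_sum_row; apply: eq_bigr => j _; rewrite rowK.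
have [j0 cj0] : exists j, 0 < c 0 j.
  apply/existsP; apply: contraNT c0; rewrite negb_exists => /forallP cn.
  have c_le0 j : c 0 j <= 0 by rewrite leNgt cn.
  apply/eqP/rowP => j; rewrite mxE; apply/eqP.
  rewrite -oppr_eq0; move: j (erefl true).
  have : \sum_j - c 0 j == 0 by rewrite sumrN cs oppr0.
  rewrite psumr_eq0 => [/allP h j _|j _]; last by rewrite oppr_ge0.
  by have := h j (mem_index_enum j).
case: (@arg_minP _ _ _ j0 (fun j => 0 < c 0 j) (fun j => w j / c 0 j) cj0) => j cj jmin.
(* The minimal ratio is the first time at which a weight reaches 0. *)
pose t := w j / c 0 j.
have t0 : 0 <= t by rewrite divr_ge0// ltW.
exists (fun i => w i - t * c 0 i); split.
- move=> i; rewrite subr_ge0; have [ci|ci] := ltP 0 (c 0 i).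
    by rewrite -ler_pdivlMr// jmin.
  by rewrite (le_trans _ (w0 i))// mulr_ge0_le0.
- by rewrite big_split/= w1 sumrN -mulr_sumr cs mulr0 oppr0 addr0.
- under eq_bigr do rewrite scalerBl -scalerA.
  by rewrite big_split/= sumrN -scaler_sumr cb scaler0 oppr0 addr0.
- by exists j; rewrite /t divfK ?subrr// gt_eqF.
Qed.

(** As long as more than m + 1 points remain, the weights can be changed so that
one of them vanishes, and its point be dropped. *)
Lemma caratheodory l (b : 'I_l -> 'rV[R]_m) (w : 'I_l -> R) :
  (forall j, 0 <= w j) -> \sum_j w j = 1 ->
  exists l' (f : 'I_l' -> 'I_l) (w' : 'I_l' -> R),
    [/\ (l' <= m.+1)%N, forall j, 0 < w' j, \sum_j w' j = 1 &
        \sum_j w' j *: b (f j) = \sum_j w j *: b j].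
Proof.
elim: l => [|l IH] in b w *.
  by move=> _; rewrite big_ord0 => /esym/eqP; rewrite oner_eq0.
have drop (w' : 'I_l.+1 -> R) j : (forall j, 0 <= w' j) -> \sum_j w' j = 1 ->
    w' j = 0 ->
    exists l' (f : 'I_l' -> 'I_l.+1) (w'' : 'I_l' -> R),
    [/\ (l' <= m.+1)%N, forall j, 0 < w'' j, \sum_j w'' j = 1 &
        \sum_j w'' j *: b (f j) = \sum_j w' j *: b j].
  move=> w'0 w'1 wj.
  have [||l' [f [w'' [? ? ? bE]]]] := IH (b \o lift j) (w' \o lift j).
  - by move=> i; exact: w'0.
  - by rewrite -w'1 [RHS](bigD1_ord j)//= wj add0r.
  exists l', (lift j \o f), w''; split=> //.
  by rewrite bE [RHS](bigD1_ord j)//= wj scale0r add0r.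
move=> w0 w1; have [/existsP[j /eqP wj]|wn0] := boolP [exists j, w j == 0].
  exact: drop wj.
have [lm|ml] := leqP l.+1 m.+1.
  exists l.+1, id, w; split=> // j.
  by rewrite lt_def w0 andbT; apply: contra wn0 => wj; apply/existsP; exists j.
have [w' [w'0 w'1 <- [j wj]]] := barycenter_vanishing_weight b ml w0 w1.
exact: drop wj.
Qed.

Definition dotv (x y : 'rV[R]_m) : R := \sum_i x 0 i * y 0 i.

Lemma dotvC x y : dotv x y = dotv y x.
Proof. by apply: eq_bigr => i _; rewrite mulrC. Qed.

Lemma dotvDr x y z : dotv x (y + z) = dotv x y + dotv x z.
Proof. by rewrite -big_split; apply: eq_bigr => i _; rewrite mxE mulrDr. Qed.

Lemma dotvZr a x y : dotv x (a *: y) = a * dotv x y.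
Proof. by rewrite mulr_sumr; apply: eq_bigr => i _; rewrite mxE mulrCA. Qed.

Lemma dotvZl a x y : dotv (a *: x) y = a * dotv x y.
Proof. by rewrite dotvC dotvZr dotvC. Qed.

Lemma dotvv_ge0 x : 0 <= dotv x x.
Proof. by apply: sumr_ge0 => i _; rewrite -expr2 sqr_ge0. Qed.

Lemma dotvv_eq0 x : dotv x x = 0 -> x = 0.
Proof.
move=> /eqP; rewrite psumr_eq0 => [/allP x0|i _]; last by rewrite -expr2 sqr_ge0.
apply/rowP => i; rewrite mxE; apply/eqP.
by have := x0 i (mem_index_enum i); rewrite -expr2 sqrf_eq0.
Qed.

(** First variation of the squared distance to the origin: its derivative at p
in the direction d is twice the dot product of p and d. *)
Lemma nearest_point_acute (p d : 'rV[R]_m) :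
  (forall s, 0 < s -> s < 1 -> dotv p p <= dotv (p + s *: d) (p + s *: d)) ->
  0 <= dotv p d.
Proof.
move=> near; rewrite leNgt; apply/negP => pd.
have dd := dotvv_ge0 d.
set e := dotv p d in pd; set f := dotv d d in dd.
have fe : 0 < f - e by rewrite subr_gt0 (lt_le_trans pd).
(* A step r > 0 changes the squared distance by 2 r e + r^2 f, which is negative
   as soon as r f < - 2 e.  This holds for s, as s f = - e + s e; the term - e
   in its denominator keeps s at most 1, and halving makes the step less
   than 1. *)
pose s := - e / (f - e).
have s0 : 0 < s by rewrite divr_gt0// oppr_gt0.
have sfe : s * (f - e) = - e by rewrite /s divfK// gt_eqF.
have s_le1 : s <= 1 by rewrite ler_pdivrMr// mul1r; lra.
pose r := s / 2.
have rr : 0 < r /\ r < 1 by rewrite /r; lra.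
have := near r rr.1 rr.2.
rewrite dotvDr dotvZr !(dotvC (p + _)) !dotvDr !dotvZr (dotvC d p) -/e -/f.
have : r * (f - e) = - e / 2 by rewrite /r mulrAC sfe.
case: rr => [r0 _]; nra.
Qed.

End Barycenters.

Section Continuity.
Local Open Scope classical_set_scope.
Variables (R : realType) (T : topologicalType).

Lemma continuousDr (f g : T -> R) :
  continuous f -> continuous g -> continuous (fun z => f z + g z).
Proof. by move=> cf cg z; apply: continuousD; [exact: cf | exact: cg]. Qed.

Lemma continuousMr (f g : T -> R) :
  continuous f -> continuous g -> continuous (fun z => f z * g z).
Proof. by move=> cf cg z; apply: continuousM; [exact: cf | exact: cg]. Qed.

Lemma continuousNr (f : T -> R) : continuous f -> continuous (fun z => - f z).
Proof. by move=> cf z; apply: continuousN; exact: cf. Qed.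

Lemma continuous_sumr (I : Type) (r : seq I) (f : I -> T -> R) :
  (forall i, continuous (f i)) -> continuous (fun z => \sum_(i <- r) f i z).
Proof.
move=> cf; elim: r => [|i r IH].
  by under eq_fun do rewrite big_nil; move=> z; exact: cst_continuous.
by under eq_fun do rewrite big_cons; exact: continuousDr.
Qed.

Lemma closed_preimage (f : T -> R) (D : set R) :
  continuous f -> closed D -> closed (f @^-1` D).
Proof. by move=> cf; apply: preimage_closed => z _; exact: cf. Qed.

End Continuity.

(** * Separation and Kolmogorov's criterion *)

Section Separation.
Local Open Scope classical_set_scope.
Variables (R : realType) (T : topologicalType) (m : nat).
Variable b : T -> 'rV[R]_m.
Hypothesis b_cont : forall i, continuous (fun z => b z 0 i).

Definition bary l (c : 'I_l -> R * T) : 'rV[R]_m := \sum_j (c j).1 *: b (c j).2.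

(** The weights and points range over a closed subset of the compact product
of l copies of [0, 1] x S. *)
Lemma exists_nearest_barycenter (S : set T) l :
  S !=set0 -> compact S -> (0 < l)%N ->
  exists c : 'I_l -> R * T,
    [/\ forall j, 0 <= (c j).1, \sum_j (c j).1 = 1, forall j, S (c j).2 &
     forall c' : 'I_l -> R * T, (forall j, 0 <= (c' j).1) ->
        \sum_j (c' j).1 = 1 -> (forall j, S (c' j).2) ->
        dotv (bary c) (bary c) <= dotv (bary c') (bary c')].
Proof.
move=> [z0 Sz0] Sc l0.
pose P : topologicalType := prod_topology (fun _ : 'I_l => (R * T)%type).
pose A : set P := [set c | forall j, (`[0, 1] `*` S) (c j)].
have Ac : compact A.
  apply: (@tychonoff _ (fun _ : 'I_l => (R * T)%type) (fun=> `[0, 1] `*` S)) => j.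
  by apply: compact_setX => //; exact: segment_compact.
have c1 j : continuous (fun c : P => (c j).1).
  by move=> c; apply: (@cvg_comp _ _ _ (fun c : P => c j) fst);
    [exact: proj_continuous|exact: cvg_fst].
have c2 j : continuous (fun c : P => (c j).2).
  by move=> c; apply: (@cvg_comp _ _ _ (fun c : P => c j) snd);
    [exact: proj_continuous|exact: cvg_snd].
pose B := A `&` ((fun c : P => \sum_j (c j).1) @^-1` [set 1]).
have Bc : compact B.
  apply: compact_closedI => //; apply: closed_preimage; last exact: closed_eq.
  exact: continuous_sumr.
have B0 : B !=set0.
  exists (fun j => ((j == Ordinal l0)%:R, z0)); split.
    by move=> j; split=> //=; rewrite in_itv/=; case: eqP; rewrite ?lexx ler01.
  by rewrite /= (bigD1 (Ordinal l0))// big1 /= ?eqxx ?addr0// => i /negbTE ->.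
have barycont i : continuous (fun c : P => bary c 0 i).
  under eq_fun do rewrite summxE.
  apply: continuous_sumr => j; under eq_fun do rewrite mxE.
  apply: continuousMr => // c.
  by apply: (@cvg_comp _ _ _ (fun c : P => (c j).2) (fun z => b z 0 i));
     [exact: c2|exact: b_cont].
have fc : continuous (fun c : P => dotv (bary c) (bary c)).
  by apply: continuous_sumr => i; exact: continuousMr.
have [c] := compact_EVT_min B0 Bc (continuous_subspaceT fc).
rewrite inE => -[Acc c_sum] cmin; exists c; split=> //.
- by move=> j; have [] := Acc j; rewrite /= in_itv/= => /andP[].
- by move=> j; have [] := Acc j.
move=> c' c'0 c'1 c'S; apply: cmin; rewrite inE; split=> // j; split=> //=.
rewrite in_itv/= c'0 /= -c'1 (bigD1 j)//= lerDl.
by apply: sumr_ge0.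
Qed.

(** Separation of the origin from a convex hull, in contrapositive form.  The
nearest point is sought among barycenters of m + 2 points, one more than
Caratheodory requires: the nearest one can then be rewritten so that one of its
points has weight 0, and that point can be replaced by any z in S.  The nearest
point p thus admits perturbations towards every b z, which forces
p.b(z) >= p.p; a z with p.b(z) <= 0 leaves only p = 0. *)
Lemma zero_barycenter (S : set T) :
  S !=set0 -> compact S ->
  (forall p, exists2 z, S z & dotv p (b z) <= 0) ->
  exists l (z : 'I_l -> T) (w : 'I_l -> R),
    [/\ (l <= m.+1)%N, forall j, S (z j), forall j, 0 < w j, \sum_j w j = 1 &
        \sum_j w j *: b (z j) = 0].
Proof.
move=> S0 Sc meet.
have [//|c [c0 c1 cS cmin]] := @exists_nearest_barycenter S m.+2 S0 Sc.
have p_eq0 : bary c = 0.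
  have [z Sz pz] := meet (bary c).
  have [//|w' [w'0 w'1 w'E [j wj]]] := barycenter_vanishing_weight
    (fun j => b (c j).2) _ c0 c1.
  have acute : 0 <= dotv (bary c) (b z - bary c).
    apply: nearest_point_acute => s s0 s1.
    pose c' i := if i == j then (s, z) else ((1 - s) * w' i, (c i).2).
    have sum' (V : zmodType) (f : R * T -> V) (g : 'I_m.+2 -> V) :
        (forall i, i != j -> f ((1 - s) * w' i, (c i).2) = g i) -> g j = 0 ->
        \sum_i f (c' i) = f (s, z) + \sum_i g i.
      move=> fg gj; rewrite (bigD1 j)//= [in RHS](bigD1 j)//= gj add0r.
      rewrite /c' eqxx; congr (_ + _); apply: eq_bigr => i ij.
      by rewrite (negbTE ij) fg.
    have -> : bary c + s *: (b z - bary c) = bary c'.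
      rewrite /bary (sum' _ (fun d => d.1 *: b d.2)
                         (fun i => (1 - s) *: (w' i *: b (c i).2)))/=.
      - rewrite -scaler_sumr w'E scalerBr scalerBl scale1r.
        by rewrite addrCA.
      - by move=> i _; rewrite scalerA.
      - by rewrite wj scale0r scaler0.
    apply: cmin.
    - move=> i; rewrite /c'; case: ifP => _ /=; first exact: ltW.
      by rewrite mulr_ge0// subr_ge0 ltW.
    - rewrite (sum' _ fst (fun i => (1 - s) * w' i))//=.
        by rewrite -mulr_sumr w'1 mulr1 addrC subrK.
      by rewrite wj mulr0.
    - by move=> i; rewrite /c'; case: ifP => _ //=; exact: cS.
  apply: dotvv_eq0; apply/eqP; rewrite eq_le dotvv_ge0 andbT.
  move: acute; rewrite dotvDr -scaleN1r dotvZr; lra.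
have [l [f [w [lm w0 w1 wE]]]] := caratheodory (fun j => b (c j).2) c0 c1.
by exists l, (fun j => (c (f j)).2), w; split=> //; rewrite wE.
Qed.

(** By separation it suffices that no p has p.b(z) > 0 at all maximizers z of a.
If p had, then on the compact set where p.b(z) <= 0 the function a would stay
below rho by a margin delta; for t small, a - t p.b would be less than rho both
there, because of the margin, and elsewhere, because a <= rho and p.b > 0. *)
Lemma kolmogorov_criterion (Z : set T) (a : T -> R) (rho : R) :
  Z !=set0 -> compact Z -> continuous a ->
  (forall z, Z z -> a z <= rho) ->
  (forall x, exists2 z, Z z & rho <= a z - dotv x (b z)) ->
  exists l (z : 'I_l -> T) (w : 'I_l -> R),
    [/\ (l <= m.+1)%N, forall j, Z (z j) /\ a (z j) = rho,
        forall j, 0 < w j, \sum_j w j = 1 & \sum_j w j *: b (z j) = 0].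
Proof.
move=> Z0 Zc ac a_le best.
have dotc p : continuous (fun z => dotv p (b z)).
  apply: continuous_sumr => i; apply: continuousMr => //.
  by move=> z; exact: cst_continuous.
pose S := Z `&` (a @^-1` [set rho]).
have Sc : compact S.
  by apply: compact_closedI => //; apply: closed_preimage => //; exact: closed_eq.
have meet p : exists2 z, S z & dotv p (b z) <= 0.
  pose Z' := Z `&` ((fun z => dotv p (b z)) @^-1` [set y | y <= 0]).
  have Z'c : compact Z'.
    by apply: compact_closedI => //; apply: closed_preimage => //; exact: closed_le.
  have Z'0 : Z' !=set0.
    have [z Zz az] := best p; exists z; split=> //=.
    by have := a_le z Zz; lra.
  have [z1] := compact_EVT_max Z'0 Z'c (continuous_subspaceT ac).
  rewrite inE => -[Zz1 pz1] z1max; exists z1 => //; split=> //=.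
  apply/eqP; rewrite eq_le a_le//= leNgt; apply/negP => az1.
  have [z2] := compact_EVT_min Z0 Zc (continuous_subspaceT (dotc p)).
  rewrite inE => Zz2 z2min.
  have pz2 : dotv p (b z2) <= 0.
    by apply: le_trans pz1; apply: z2min; rewrite inE.
  set delta := rho - a z1; have delta0 : 0 < delta by rewrite subr_gt0.
  (* This step t is small enough: - t p.b(z) < delta for every z in Z, as
     p.b(z2) is the minimum of p.b over Z. *)
  have t0 : 0 < delta / (1 - dotv p (b z2)) by rewrite divr_gt0//; lra.
  have tE : delta / (1 - dotv p (b z2)) * (1 - dotv p (b z2)) = delta.
    by rewrite divfK// gt_eqF//; lra.
  set t := delta / _ in t0 tE.
  have [z Zz] := best (t *: p); rewrite dotvZl => az.
  have az_le := a_le z Zz.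
  have pz : dotv p (b z) <= 0 by rewrite -(pmulr_rle0 _ t0); lra.
  have : a z <= a z1 by apply: z1max; rewrite inE.
  have : dotv p (b z2) <= dotv p (b z) by apply: z2min; rewrite inE.
  rewrite -(ler_pM2l t0); rewrite /delta in tE *; nra.
have S0 : S !=set0 by have [z Sz _] := meet 0; exists z.
have [l [z [w [? zS ? ? ?]]]] := zero_barycenter S0 Sc meet.
by exists l, z, w; split=> // j; have [] := zS j.
Qed.

End Separation.

(** * Real and imaginary parts, uniformly in the scalar field *)

Definition scalar_im (R : realType) (K : scalars) : scalar_field R K -> R :=
  match K return scalar_field R K -> R with
  | RealScalars => fun=> 0
  | ComplexScalars => @complex.Im R
  end.

Definition scalar_mk (R : realType) (K : scalars) (a b : R) : scalar_field R K :=
  match K return scalar_field R K with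
  | RealScalars => a
  | ComplexScalars => Complex a b
  end.

Section Scalars.
Variables (R : realType) (K : scalars).
Local Notation F := (scalar_field R K).
Local Notation re := (@scalar_re R K).
Local Notation im := (@scalar_im R K).
Local Notation conj := (scalar_conj R K).
Local Notation real := (scalar_of_real R K).
Local Notation mk := (scalar_mk K).
Implicit Types (x y : F) (a : R).

Lemma scalar_ext x y : re x = re y -> im x = im y -> x = y.
Proof. by case: K x y => [|[a b] [c d] /= -> ->]. Qed.

Lemma scalar_mkE x : mk (re x) (im x) = x.
Proof. by case: K x => [|[]]. Qed.

Lemma reD x y : re (x + y) = re x + re y.
Proof. by case: K x y => [|[a b] [c d]]. Qed.

Lemma imD x y : im (x + y) = im x + im y.
Proof. by case: K x y => [x y|[a b] [c d]] //=; rewrite addr0. Qed.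

Lemma reM x y : re (x * y) = re x * re y - im x * im y.
Proof. by case: K x y => [x y|[a b] [c d]] //=; rewrite mulr0 subr0. Qed.

Lemma imM x y : im (x * y) = re x * im y + im x * re y.
Proof. by case: K x y => [x y|[a b] [c d]] //=; rewrite mulr0 mul0r addr0. Qed.

Lemma re_conj x : re (conj x) = re x.
Proof. by case: K x => [|[]]. Qed.

Lemma im_conj x : im (conj x) = - im x.
Proof. by case: K x => [x|[]] //=; rewrite oppr0. Qed.

Lemma re_real a : re (real a) = a.
Proof. by case: K. Qed.

Lemma im_real a : im (real a) = 0.
Proof. by case: K. Qed.

Lemma re_sum I r (P : pred I) (f : I -> F) :
  re (\sum_(i <- r | P i) f i) = \sum_(i <- r | P i) re (f i).
Proof. by apply: (big_morph re reD); case: K. Qed.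

Lemma im_sum I r (P : pred I) (f : I -> F) :
  im (\sum_(i <- r | P i) f i) = \sum_(i <- r | P i) im (f i).
Proof. by apply: (big_morph im imD); case: K. Qed.

(** The factor [mk 0 1] is i over the complex numbers and 0 over the reals. *)
Lemma im_re_mk x : im x = - re (mk 0 1 * x).
Proof. by case: K x => [x|[a b]] /=; rewrite mul0r ?oppr0// mul1r sub0r opprK. Qed.

Section ScalarContinuity.
Local Open Scope classical_set_scope.
Variable T : topologicalType.

(** Working with the two real coordinates avoids any topology on the scalar
field itself. *)
Definition scalar_continuous (f : T -> F) :=
  continuous (fun z => re (f z)) /\ continuous (fun z => im (f z)).

Lemma scalar_continuous_cst x : scalar_continuous (fun=> x).
Proof. by split=> z; exact: cst_continuous. Qed.

Lemma scalar_continuousM (f g : T -> F) : scalar_continuous f ->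
  scalar_continuous g -> scalar_continuous (fun z => f z * g z).
Proof.
move=> [f1 f2] [g1 g2]; split.
  under eq_fun do rewrite reM; apply: continuousDr; first exact: continuousMr.
  by apply: continuousNr; exact: continuousMr.
by under eq_fun do rewrite imM; apply: continuousDr; exact: continuousMr.
Qed.

Lemma scalar_continuous_sum I (r : seq I) (f : I -> T -> F) :
  (forall i, scalar_continuous (f i)) ->
  scalar_continuous (fun z => \sum_(i <- r) f i z).
Proof.
move=> fc; split.
  by under eq_fun do rewrite re_sum; apply: continuous_sumr => i; have [] := fc i.
by under eq_fun do rewrite im_sum; apply: continuous_sumr => i; have [] := fc i.
Qed.

Lemma scalar_continuous_conj (f : T -> F) :
  scalar_continuous f -> scalar_continuous (fun z => conj (f z)).
Proof.
move=> [f1 f2]; split; first by under eq_fun do rewrite re_conj.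
by under eq_fun do rewrite im_conj; exact: continuousNr.
Qed.

Lemma scalar_continuous_mk (f g : T -> R) :
  continuous f -> continuous g -> scalar_continuous (fun z => mk (f z) (g z)).
Proof.
rewrite /scalar_continuous; case: K => fc gc; split=> //= z.
exact: cst_continuous.
Qed.

End ScalarContinuity.

(** * The real inner product on column vectors *)

Section Inner.
Variable n : nat.
Implicit Types (u v w : 'cV[F]_n) (A : 'M[F]_n).

Definition inner u v : R := re ((ctrmx u *m v) 0 0).

Lemma ctrmx_mulE u v : (ctrmx u *m v) 0 0 = \sum_i conj (u i 0) * v i 0.
Proof. by rewrite mxE; apply: eq_bigr => i _; rewrite !mxE. Qed.

Lemma innerE u v : inner u v = \sum_i (re (u i 0) * re (v i 0) + im (u i 0) * im (v i 0)).
Proof.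
rewrite /inner ctrmx_mulE re_sum; apply: eq_bigr => i _.
by rewrite reM re_conj im_conj mulNr opprK.
Qed.

Lemma innerC u v : inner u v = inner v u.
Proof. by rewrite !innerE; apply: eq_bigr => i _; congr (_ + _); exact: mulrC. Qed.

Lemma innerDr u v w : inner u (v + w) = inner u v + inner u w.
Proof. by rewrite /inner mulmxDr mxE reD. Qed.

Lemma innerZr a u v : inner u (real a *: v) = a * inner u v.
Proof. by rewrite /inner -scalemxAr mxE reM re_real im_real mul0r subr0. Qed.

Lemma innerNr u v : inner u (- v) = - inner u v.
Proof. by rewrite -scaleN1r -(rmorphN1 real) innerZr mulN1r. Qed.

Lemma inner0r u : inner u 0 = 0.
Proof. by rewrite -(scale0r 0) -(rmorph0 real) innerZr mul0r. Qed.

Lemma inner_sumr I (r : seq I) (f : I -> 'cV[F]_n) u :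
  inner u (\sum_(i <- r) f i) = \sum_(i <- r) inner u (f i).
Proof. exact: (big_morph _ (innerDr u) (inner0r u)). Qed.

Lemma inner_ge0 u : 0 <= inner u u.
Proof.
by rewrite innerE; apply: sumr_ge0 => i _; rewrite -!expr2 addr_ge0// sqr_ge0.
Qed.

Lemma sqr_coord_le u i : re (u i 0) ^+ 2 <= inner u u /\ im (u i 0) ^+ 2 <= inner u u.
Proof.
rewrite innerE (bigD1 i)//=; set s := \sum_(_ | _) _.
have s0 : 0 <= s by apply: sumr_ge0 => j _; rewrite -!expr2 addr_ge0// sqr_ge0.
by split; nra.
Qed.

Lemma inner_eq0 u : inner u u <= 0 -> u = 0.
Proof.
move=> u0; apply/colP => i; rewrite mxE.
have [r s] := sqr_coord_le u i.
have zero (a : R) : a ^+ 2 <= inner u u -> a = 0.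
  by move=> h; apply/eqP; rewrite -sqrf_eq0 eq_le sqr_ge0 (le_trans h).
by apply: scalar_ext; [rewrite (zero _ r)|rewrite (zero _ s)]; case: K.
Qed.

Lemma vnorm2_ge0 u : 0 <= vnorm2 u.
Proof. exact: sqrtr_ge0. Qed.

Lemma sqr_vnorm2 u : vnorm2 u ^+ 2 = inner u u.
Proof. by rewrite sqr_sqrtr// inner_ge0. Qed.

Lemma vnorm2_eq1 u : vnorm2 u = 1 <-> inner u u = 1.
Proof.
split=> [u1|u1]; first by rewrite -sqr_vnorm2 u1 expr1n.
by rewrite /vnorm2 -/(inner u u) u1 sqrtr1.
Qed.

Lemma vnorm2_eq0 u : vnorm2 u = 0 -> u = 0.
Proof. by move=> u0; apply: inner_eq0; rewrite -sqr_vnorm2 u0 expr0n. Qed.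

Lemma inner_combination u v a : inner u u = 1 ->
  inner (v + real a *: u) (v + real a *: u) =
  vnorm2 v ^+ 2 + 2 * a * inner u v + a ^+ 2.
Proof.
move=> u1; rewrite sqr_vnorm2 innerDr innerZr !(innerC (v + _)) !innerDr !innerZr u1.
rewrite (innerC v u); ring.
Qed.

Lemma cauchy_schwarz u v : vnorm2 u = 1 -> inner u v <= vnorm2 v.
Proof.
move=> /vnorm2_eq1 u1; have [v0|v0] := eqVneq (vnorm2 v) 0.
  by rewrite v0 (vnorm2_eq0 v0) inner0r.
have {}v0 : 0 < vnorm2 v by rewrite lt_def v0 vnorm2_ge0.
have := inner_ge0 (v + real (- vnorm2 v) *: u); rewrite inner_combination// => h.
by rewrite -(ler_pM2l v0); lra.
Qed.

Lemma exists_dual_unit v w : vnorm2 w = 1 ->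
  exists2 u, vnorm2 u = 1 & inner u v = vnorm2 v.
Proof.
move=> w1; have [v0|v0] := eqVneq (vnorm2 v) 0.
  by exists w => //; rewrite v0 (vnorm2_eq0 v0) inner0r.
have vv : inner (real (vnorm2 v)^-1 *: v) v = vnorm2 v.
  by rewrite innerC innerZr -sqr_vnorm2 expr2 mulKf.
exists (real (vnorm2 v)^-1 *: v) => //; apply/vnorm2_eq1.
by rewrite innerZr vv mulVf.
Qed.

Lemma ctrmx_mul_unit u : vnorm2 u = 1 -> (ctrmx u *m u) 0 0 = 1.
Proof.
move/vnorm2_eq1 => u1; rewrite -[1](rmorph1 real); apply: scalar_ext.
  by rewrite re_real.
rewrite ctrmx_mulE im_sum im_real big1// => i _.
by rewrite imM re_conj im_conj mulNr mulrC subrr.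
Qed.

(** Equality case of Cauchy-Schwarz: the squared norm of A v - rho u is at most
rho^2 - 2 rho^2 + rho^2 = 0. *)
Lemma extremal_pair_eq u v A rho : vnorm2 u = 1 -> vnorm2 (A *m v) <= rho ->
  inner u (A *m v) = rho -> (ctrmx u *m A *m v) 0 0 = real rho.
Proof.
move=> u1 Av_le uAv.
have Av : A *m v = real rho *: u.
  apply/eqP; rewrite -subr_eq0 -scaleNr -rmorphN; apply/eqP/inner_eq0.
  rewrite inner_combination; last exact/vnorm2_eq1.
  by rewrite uAv; have := vnorm2_ge0 (A *m v); nra.
by rewrite -mulmxA Av -scalemxAr mxE ctrmx_mul_unit// mulr1.
Qed.

Lemma unit_vector_exists : (0 < n)%N -> exists u, vnorm2 u = 1.
Proof.
move=> n0; exists (delta_mx (Ordinal n0) 0); apply/vnorm2_eq1.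
rewrite innerE (bigD1 (Ordinal n0))//= big1 ?mxE ?eqxx/=.
  by rewrite addr0; case: K => /=; rewrite ?mulr0 ?mulr1 addr0.
move=> i /negbTE i0; rewrite !mxE i0 /=.
by case: K => /=; rewrite !mulr0 addr0.
Qed.

Lemma rank_unit_dyad u v : vnorm2 u = 1 -> vnorm2 v = 1 ->
  \rank (u *m ctrmx v) = 1%N.
Proof.
move=> u1 v1; apply/eqP; rewrite eqn_leq mulmx_max_rank lt0n mxrank_eq0.
apply: contra_neq (@oner_neq0 F) => uv0.
have <- : (ctrmx u *m (u *m ctrmx v) *m v) 0 0 = 1.
  rewrite mulmxA -mulmxA mxE big_ord1.
  by rewrite !ctrmx_mul_unit// mulr1.
by rewrite uv0 mulmx0 mul0mx mxE.
Qed.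

End Inner.

End Scalars.

(** * The spectral norm as a maximum over pairs of unit vectors *)

Section UnitPairs.
Local Open Scope classical_set_scope.
Variables (R : realType) (K : scalars) (n : nat).
Local Notation F := (scalar_field R K).
Local Notation re := (@scalar_re R K).
Local Notation im := (@scalar_im R K).
Local Notation real := (scalar_of_real R K).
Local Notation vec_coords := ('rV[R]_n * 'rV[R]_n)%type.

(** Parametrizing vectors by two real rows, for both scalar fields, gives access
to the compactness of closed bounded sets of real rows. *)
Definition vec (p : vec_coords) : 'cV[F]_n := \col_i scalar_mk K (p.1 0 i) (p.2 0 i).

Definition coords (v : 'cV[F]_n) : vec_coords :=
  (\row_i re (v i 0), \row_i im (v i 0)).

Lemma coordsK : cancel coords vec.
Proof. by move=> v; apply/colP => i; rewrite !mxE scalar_mkE. Qed.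

Definition unit_box : set vec_coords :=
  [set x : 'rV[R]_n | forall i, `[-1, 1] (x 0 i)] `*`
  [set x : 'rV[R]_n | forall i, `[-1, 1] (x 0 i)].

(** Over the reals the norm constrains the first row of coordinates alone; the
box bounds the second one and so makes the set compact. *)
Definition unit_pairs : set (vec_coords * vec_coords) :=
  (unit_box `*` unit_box) `&` ((fun z => inner (vec z.1) (vec z.1)) @^-1` [set 1])
  `&` ((fun z => inner (vec z.2) (vec z.2)) @^-1` [set 1]).

Lemma unit_pairsP z : unit_pairs z -> vnorm2 (vec z.1) = 1 /\ vnorm2 (vec z.2) = 1.
Proof. by move=> [[_ z1] z2]; split; apply/vnorm2_eq1. Qed.

Lemma coords_unit_pair u v : vnorm2 u = 1 -> vnorm2 v = 1 ->
  unit_pairs (coords u, coords v).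
Proof.
have box (w : 'cV[F]_n) : inner w w = 1 -> unit_box (coords w).
  have sq (a : R) : a ^+ 2 <= 1 -> -1 <= a <= 1.
    by move=> a1; apply/andP; split; nra.
  by move=> w1; split=> i /=; rewrite mxE in_itv/= sq// -w1;
    have [] := sqr_coord_le w i.
move=> /vnorm2_eq1 u1 /vnorm2_eq1 v1.
by split; [split; [split; exact: box|]|]; rewrite /= coordsK.
Qed.

Lemma coord_row_continuous (T : topologicalType) (f : T -> 'rV[R]_n) i :
  continuous f -> continuous (fun z => f z 0 i).
Proof.
move=> fc z; apply: (@cvg_comp _ _ _ f (fun x : 'rV[R]_n => x 0 i)); first exact: fc.
exact: coord_continuous.
Qed.

Lemma inner_continuous (T : topologicalType) (p q : T -> vec_coords) (A : 'M[F]_n) :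
  continuous p -> continuous q ->
  continuous (fun z => inner (vec (p z)) (A *m vec (q z))).
Proof.
have vecc (r : T -> vec_coords) i : continuous r ->
    scalar_continuous (fun z => vec (r z) i 0).
  move=> rc; under eq_fun do rewrite mxE.
  apply: scalar_continuous_mk; apply: coord_row_continuous => z.
    by apply: (@cvg_comp _ _ _ r fst); [exact: rc|exact: cvg_fst].
  by apply: (@cvg_comp _ _ _ r snd); [exact: rc|exact: cvg_snd].
move=> pc qc.
suff [] : scalar_continuous (fun z => (ctrmx (vec (p z)) *m (A *m vec (q z))) 0 0).
  by [].
under eq_fun do rewrite ctrmx_mulE.
apply: scalar_continuous_sum => i; apply: scalar_continuousM.
  exact/scalar_continuous_conj/vecc.
under eq_fun do rewrite mxE.
apply: scalar_continuous_sum => j; apply: scalar_continuousM; last exact: vecc.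
exact: scalar_continuous_cst.
Qed.

Lemma form_continuous A :
  continuous (fun z : vec_coords * vec_coords => inner (vec z.1) (A *m vec z.2)).
Proof. by apply: inner_continuous => z; [exact: cvg_fst|exact: cvg_snd]. Qed.

Lemma compact_unit_pairs : compact unit_pairs.
Proof.
have box : compact unit_box.
  by apply: compact_setX; apply: (@rV_compact R n (fun=> `[-1, 1])) => i;
    exact: segment_compact.
apply: compact_closedI; first apply: compact_closedI; first exact: compact_setX.
- apply: closed_preimage; last exact: closed_eq.
  have := @inner_continuous (vec_coords * vec_coords)%type fst fst 1%:M.
  under eq_fun do rewrite mul1mx; apply=> z; exact: cvg_fst.
- apply: closed_preimage; last exact: closed_eq.
  have := @inner_continuous (vec_coords * vec_coords)%type snd snd 1%:M.
  under eq_fun do rewrite mul1mx; apply=> z; exact: cvg_snd.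
Qed.

Lemma unit_pairs_nonempty : (0 < n)%N -> unit_pairs !=set0.
Proof.
case/(unit_vector_exists R K) => u u1.
by exists (coords u, coords u); exact: coords_unit_pair.
Qed.

(** For a fixed v the best u is the direction of A v, so the supremum of
|A v| over unit v is that of a continuous function on a compact set. *)
Lemma spectral_norm_variational (A : 'M[F]_n) : (0 < n)%N ->
  (forall v, vnorm2 v = 1 -> vnorm2 (A *m v) <= spectral_norm A) /\
  exists u v, [/\ vnorm2 u = 1, vnorm2 v = 1 & inner u (A *m v) = spectral_norm A].
Proof.
move=> n0.
have [z] := compact_EVT_max (unit_pairs_nonempty n0) compact_unit_pairs
  (continuous_subspaceT (form_continuous (A := A))).
rewrite inE => /unit_pairsP[z1 z2] zmax.
set rho := inner _ _ in zmax.
have Av_le v : vnorm2 v = 1 -> vnorm2 (A *m v) <= rho.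
  move=> v1; have [u u1 <-] := exists_dual_unit (A *m v) v1.
  have := zmax (coords u, coords v); rewrite inE /= !coordsK.
  by apply; exact: coords_unit_pair.
have ub : ubound [set vnorm2 (A *m v) | v in [set v | vnorm2 v = 1]] rho.
  by move=> _ [v v1 <-]; exact: Av_le.
have -> : spectral_norm A = rho; last first.
  by split=> //; exists (vec z.1), (vec z.2).
apply/eqP; rewrite eq_le; apply/andP; split.
  by apply: ge_sup => //; exists (vnorm2 (A *m vec z.2)), (vec z.2).
apply: le_trans (cauchy_schwarz _ z1) _; apply: ub_le_sup; first by exists rho.
by exists (vec z.2).
Qed.

Lemma form_le_spectral_norm (A : 'M[F]_n) u v :
  vnorm2 u = 1 -> vnorm2 v = 1 -> inner u (A *m v) <= spectral_norm A.
Proof.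
move=> u1 v1; apply: le_trans (cauchy_schwarz _ u1) _.
have n0 : (0 < n)%N.
  case: n u u1 {A v v1} => // u /vnorm2_eq1/eqP.
  by rewrite innerE big_ord0 eq_sym oner_eq0.
by have [-> ] := spectral_norm_variational A n0.
Qed.

End UnitPairs.

(** * From a scalar subspace to real linear conditions *)

(** Over the complex numbers the generators are a basis together with i times
that basis. *)
Lemma real_generators (R : realType) (K : scalars) (V : vectType (scalar_field R K))
    (U : {vspace V}) :
  exists m (G : 'I_m -> V), [/\ max_terms K (\dim U) = m.+1, forall i, G i \in U &
    forall X, X \in U -> exists x : 'I_m -> R,
      X = \sum_i scalar_of_real R K (x i) *: G i].
Proof.
case: K V U => V U.
  exists (\dim U), (fun i => (vbasis U)`_i); split=> // [i|X XU].
    by rewrite vbasis_mem// mem_nth// size_tuple.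
  by exists (fun i => coord (vbasis U) i X); exact: coord_vbasis.
have eU i : (i < \dim U)%N -> (vbasis U)`_i \in U.
  by move=> iU; rewrite vbasis_mem// mem_nth// size_tuple.
exists (\dim U + \dim U)%N, (fun i => match split i with
  | inl j => (vbasis U)`_j | inr j => (Complex 0 1 : R[i]) *: (vbasis U)`_j end).
split=> [|i|X XU]; first by rewrite addnn.
  by case: split => j; rewrite ?memvZ// eU.
pose c j : R[i] := coord (vbasis U) j X.
exists (fun i => match split i with
  | inl j => complex.Re (c j) | inr j => complex.Im (c j) end).
rewrite big_split_ord/=.
under eq_bigr => i _ do rewrite (unsplitK (inl i)).
under [X in _ = _ + X]eq_bigr => i _ do rewrite (unsplitK (inr i)) scalerA.
rewrite {1}(coord_vbasis XU) -big_split; apply: eq_bigr => i _ /=.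
rewrite -scalerDl -/(c i); congr (_ *: _).
by rewrite [LHS]complexE [X in _ + X]mulrC.
Qed.

Section Orthogonality.
Variables (R : realType) (K : scalars) (n l : nat).
Local Notation F := (scalar_field R K).
Local Notation re := (@scalar_re R K).
Local Notation real := (scalar_of_real R K).
Variables (u v : 'I_l -> 'cV[F]_n) (w : 'I_l -> R).

Lemma re_dyad_sum X :
  re (\sum_(j < l) real (w j) * (ctrmx (u j) *m X *m v j) 0 0) =
  \sum_j w j * inner (u j) (X *m v j).
Proof.
rewrite re_sum; apply: eq_bigr => j _.
by rewrite reM re_real im_real mul0r subr0 -mulmxA.
Qed.

(** The imaginary part of the sum at X is minus its real part at i X. *)
Lemma annihilate_re (XX : {vspace 'M[F]_n}) :
  (forall X, X \in XX -> \sum_j w j * inner (u j) (X *m v j) = 0) ->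
  forall X, X \in XX ->
    \sum_(j < l) real (w j) * (ctrmx (u j) *m X *m v j) 0 0 = 0.
Proof.
move=> ann X XXX; apply: scalar_ext.
  by rewrite re_dyad_sum ann//; case: (K).
rewrite im_re_mk mulr_sumr.
under eq_bigr => j _ do rewrite mulrCA.
have -> : \sum_(j < l) real (w j) * (scalar_mk K 0 1 * (ctrmx (u j) *m X *m v j) 0 0)
    = \sum_(j < l) real (w j) * (ctrmx (u j) *m (scalar_mk K 0 1 *: X) *m v j) 0 0.
  by apply: eq_bigr => j _; rewrite -scalemxAr -scalemxAl [in RHS]mxE.
by rewrite re_dyad_sum ann ?memvZ// oppr0; case: (K).
Qed.

End Orthogonality.

(** * The characterization of spectral approximations *)

Section Necessity.
Variables (R : realType) (K : scalars) (n : nat).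
Local Notation F := (scalar_field R K).
Local Notation real := (scalar_of_real R K).
Variables (XX : {vspace 'M[F]_n}) (Y Xs : 'M[F]_n).

(** Kolmogorov's criterion for the functions a(z) = <u, (Y - Xs) v> and
b(z) = (<u, G_i v>)_i of a unit pair z = (u, v).  Its hypothesis at x is
optimality of Xs against Xs + sum_i x_i G_i, tested at a pair at which the
spectral norm of the new residual is attained. *)
Lemma optimal_dyads : (0 < n)%N -> spectral_approximation Y XX Xs ->
  exists l (u v : 'I_l -> 'cV[F]_n) (w : 'I_l -> R),
    [/\ (l <= max_terms K (\dim XX))%N,
        forall j, [/\ vnorm2 (u j) = 1, vnorm2 (v j) = 1 &
          inner (u j) ((Y - Xs) *m v j) = spectral_norm (Y - Xs)],
        forall j, 0 < w j, \sum_j w j = 1 &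
        forall X, X \in XX -> \sum_j w j * inner (u j) (X *m v j) = 0].
Proof.
move=> n0 [hXs opt].
have [m [G [-> GX Ggen]]] := real_generators XX.
pose b (z : ('rV[R]_n * 'rV[R]_n) * ('rV[R]_n * 'rV[R]_n)) : 'rV[R]_m :=
  \row_i inner (vec K z.1) (G i *m vec K z.2).
have b_cont i : continuous (fun z => b z 0 i).
  by under eq_fun do rewrite mxE; exact: form_continuous.
have sum_inner (x : 'I_m -> R) u v :
    inner u ((\sum_i real (x i) *: G i) *m v) = \sum_i x i * inner u (G i *m v).
  rewrite mulmx_suml inner_sumr; apply: eq_bigr => i _.
  by rewrite -scalemxAl innerZr.
have [|x|l [z [w [lm zP w0 w1 wb]]]] := kolmogorov_criterion b_cont
    (unit_pairs_nonempty R K n0) (@compact_unit_pairs R K n)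
    (form_continuous (A := Y - Xs)) (rho := spectral_norm (Y - Xs)).
- by move=> z /unit_pairsP[z1 z2]; exact: form_le_spectral_norm.
- pose X := Xs + \sum_i real (x 0 i) *: G i.
  have XXX : X \in XX by rewrite memvD// memv_suml// => i _; rewrite memvZ.
  have [_ [u [v [u1 v1 uv]]]] := spectral_norm_variational (Y - X) n0.
  exists (coords u, coords v); first exact: coords_unit_pair.
  apply: le_trans (opt X XXX) _; rewrite -uv /= !coordsK.
  rewrite /X opprD addrA mulmxDl mulNmx innerDr innerNr lerD2l lerN2 sum_inner.
  rewrite le_eqVlt; apply/orP; left; apply/eqP.
  by apply: eq_bigr => i _; rewrite mxE /= !coordsK.
exists l, (fun j => vec K (z j).1), (fun j => vec K (z j).2), w; split=> //.
  by move=> j; have [/unit_pairsP[? ?] ?] := zP j.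
move=> X XXX; have [x ->] := Ggen X XXX.
under eq_bigr => j _ do rewrite sum_inner mulr_sumr.
rewrite exchange_big big1// => i _.
under eq_bigr => j _ do rewrite mulrCA.
rewrite -mulr_sumr; move/rowP/(_ i): wb; rewrite summxE mxE => wb.
rewrite (_ : \sum_j _ = 0) ?mulr0//; rewrite -[RHS]wb.
by apply: eq_bigr => j _; rewrite !mxE.
Qed.

End Necessity.

Theorem theorem6 (R : realType) (K : scalars) (n k : nat)
    (XX : {vspace 'M[scalar_field R K]_n}) (hk : \dim XX = k)
    (Y Xs : 'M[scalar_field R K]_n) (hY : Y \notin XX) (hXs : Xs \in XX) :
  spectral_approximation Y XX Xs <->
  exists (l : nat) (u v : 'I_l -> 'cV[scalar_field R K]_n) (w : 'I_l -> R),
    (1 <= l <= max_terms K k)%N /\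
    (forall j, \rank (u j *m ctrmx (v j)) = 1%N) /\
    (forall j, vnorm2 (u j) = 1 /\ vnorm2 (v j) = 1) /\
    (forall j, 0 < w j) /\
    \sum_(j < l) w j = 1 /\
    (forall X, X \in XX ->
       \sum_(j < l) scalar_of_real R K (w j) * (ctrmx (u j) *m X *m v j) 0 0 = 0) /\
    (forall j, (ctrmx (u j) *m (Y - Xs) *m v j) 0 0
       = scalar_of_real R K (spectral_norm (Y - Xs))).
Proof.
split=> [opt|[l [u [v [w [_ [_ [uv1 [w0 [w1 [ann ext]]]]]]]]]]].
  (* In dimension 0 all matrices are equal, and Y would be in the subspace. *)
  have n0 : (0 < n)%N.
    rewrite lt0n; apply: contraNneq hY => n0.
    by move: XX Y Xs hXs {hk opt}; rewrite n0 => U A B; rewrite (flatmx0 A) mem0v.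
  have [l [u [v [w [lm uv w0 w1 ann]]]]] := optimal_dyads n0 opt.
  exists l, u, v, w; split.
    rewrite -hk lm andbT lt0n; apply/eqP => l0; subst l.
    by move: w1; rewrite big_ord0 => /esym/eqP; rewrite oner_eq0.
  split; first by move=> j; have [? ? _] := uv j; exact: rank_unit_dyad.
  split; first by move=> j; have [] := uv j.
  do 3![split=> //]; first exact: annihilate_re.
  move=> j; have [u1 v1 uDv] := uv j; apply: extremal_pair_eq => //.
  by have [Dv_le _] := spectral_norm_variational (Y - Xs) n0; exact: Dv_le.
split=> // X XXX.
rewrite -[leLHS]mulr1 -[leRHS]mulr1 -w1 !mulr_sumr.
have XsX : Xs - X \in XX by rewrite memvB.
have ann_re : \sum_j w j * inner (u j) ((Xs - X) *m v j) = 0.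
  by rewrite -re_dyad_sum ann//; case: (K).
have -> : \sum_i spectral_norm (Y - Xs) * w i =
    \sum_j w j * inner (u j) ((Y - X) *m v j).
  have D : Y - X = (Y - Xs) + (Xs - X) by rewrite addrA subrK.
  under [RHS]eq_bigr => j _ do rewrite D mulmxDl innerDr mulrDr.
  rewrite big_split /= ann_re addr0.
  by apply: eq_bigr => j _; rewrite /inner mulmxA ext re_real mulrC.
apply: ler_sum => j _; rewrite mulrC ler_pM2r//.
by have [u1 v1] := uv1 j; exact: form_le_spectral_norm.
Qed.
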